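(* Let $G$ be a finitely generated group, let $(X,d)$ be a compact metric space, let $\varphi:G\times X\to X$ be a continuous action, and let $H$ be a finite index subgroup of $G$. If the restricted action $\varphi:H\times X\to X$ has the persistent shadowing property, then $\varphi:G\times X\to X$ has the persistent shadowing property.
   Context: A continuous action $\varphi:G\times X\to X$ is an action (so $\varphi(gh,x)=\varphi(g,\varphi(h,x))$ and $\varphi(e,x)=x$) of a finitely generated group $G$ with the discrete topology on a compact metric space $(X,d)$ such that $\varphi$ is continuous. Let $S$ be a finite generating set of $G$. For continuous actions $\varphi,\psi$ of $G$ on $X$ put $d_S(\varphi,\psi)=\sup\{d(\varphi(s,x),\psi(s,x)): x\in X, s\in S\}$. A map $f:G\to X$ is a $\delta$-pseudo orbit for $\psi$ (with respect to $S$) if $d(f(sg),\psi(s,f(g)))<\delta$ for all $s\in S$, $g\in G$. It is $(\psi,\epsilon)$-shadowed by $p\in X$ if $d(f(g),\psi(g,p))<\epsilon$ for all $g\in G$. The action $\varphi$ has the persistent shadowing property (with respect to $S$) if for every $\epsilon>0$ there is $\delta>0$ such that for every continuous action $\psi:G\times X\to X$ with $d_S(\varphi,\psi)<\delta$, every $\delta$-pseudo orbit $f:G\to X$ for $\psi$ can be $(\psi,\epsilon)$-shadowed by a point $p\in X$. The property does not depend on the choice of the symmetric finite generating set. The same definitions apply to the (finitely generated) group $H$ with a finite generating set of $H$. *)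

(* Defs.v *)
From HB Require Import structures.
From mathcomp Require Import all_boot all_order all_algebra.
From mathcomp Require Import all_classical all_reals all_analysis.

Set Implicit Arguments.
Unset Strict Implicit.
Unset Printing Implicit Defensive.

Import Order.TTheory GRing.Theory Num.Theory.

Local Open Scope classical_set_scope.
Local Open Scope ring_scope.

(** Possibly infinite groups are MathComp's [groupType]s, and a subgroup of [G]
    is a [subGroupType P], i.e. the subset [P] of [G] seen as a group whose
    inclusion [\val] into [G] is a morphism.  Such a structure forces [P] to be
    closed under the group operations, and every subgroup arises in this way. *)

Section Groups.
Variable G : groupType.

Definition is_subgroup (K : set G) : Prop := group_closed [in K].

(** [S] generates [G] as a group; [S] need not be symmetric. *)
Definition generating (S : set G) : Prop := smallest is_subgroup S = [set: G].

Definition left_coset (P : {pred G}) (g : G) : set G :=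
  [set (g * h)%g | h in [set` P]].

Definition finite_index (P : {pred G}) : Prop :=
  finite_set (range (left_coset P)).

End Groups.

Section Actions.
Variables (R : realType) (X : metricType R) (G : groupType).
Implicit Types (phi psi : G -> X -> X) (S : set G) (f : G -> X).

Record continuous_action phi : Prop := ContinuousAction {
  action1 : forall x, phi 1%g x = x ;
  actionM : forall g h x, phi (g * h)%g x = phi g (phi h x) ;
  action_continuous :
    continuous (fun gx : discrete_topology G * X => phi gx.1 gx.2) }.

(** On a compact space and for [S] finite this is a supremum of a bounded set.
    The library convention [sup set0 = 0] gives distance 0 when [S] or [X] is
    empty. *)
Definition action_dist S phi psi : R :=
  sup [set mdist (phi s x) (psi s x) | s in S & x in [set: X]].

Definition pseudo_orbit S psi (delta : R) f : Prop :=
  forall s g, S s -> mdist (f (s * g)%g) (psi s (f g)) < delta.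

Definition shadowed psi (eps : R) f (p : X) : Prop :=
  forall g, mdist (f g) (psi g p) < eps.

Definition persistent_shadowing S phi : Prop :=
  forall eps : R, 0 < eps ->
  exists2 delta : R, 0 < delta &
  forall psi, continuous_action psi -> action_dist S phi psi < delta ->
  forall f, pseudo_orbit S psi delta f ->
  exists p : X, shadowed psi eps f p.

End Actions.

Definition restrict_action (X : Type) (G : groupType) (P : {pred G})
    (H : subGroupType P) (phi : G -> X -> X) : H -> X -> X :=
  fun h x => phi (\val h) x.
Arguments restrict_action {X G P} H phi.

(* Main.v *)
Require Import Defs.
From HB Require Import structures.
From mathcomp Require Import all_boot all_order all_algebra.
From mathcomp Require Import all_classical all_reals all_analysis.
From mathcomp Require Import lra.

Set Implicit Arguments.
Unset Strict Implicit.
Unset Printing Implicit Defensive.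

Import Order.TTheory GRing.Theory Num.Theory.

Local Open Scope classical_set_scope.

(** Let [psi] be an action close to [phi] on [S] and let [f] be a pseudo orbit
    of [psi].  Restricted to [H] it is a pseudo orbit of the restriction of
    [psi], so the hypothesis on [H] yields a point [p] whose [H]-orbit under
    [psi] follows [f] on [H].  Finitely many left cosets [c H] cover [G], and
    [f (c h)] is close to [psi c (f h)], which is close to
    [psi c (psi h p) = psi (c h) p]; hence [p] shadows [f] on all of [G].

    Two uniformity questions have to be settled, because [psi] is not given in
    advance: [f (g k)] must be close to [psi g (f k)] for all [k] when [g] is a
    generator of [H] or a coset representative, not only for [g] in [S], and
    the modulus of continuity of [psi c] must not depend on [psi].  Both follow
    once [psi g] is known to be uniformly close to [phi g], since [phi g] is a
    fixed uniformly continuous map of the compact space [X].  The elements [g]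
    for which [psi g] is uniformly close to [phi g], and [f (g k)] to
    [psi g (f k)], as [delta] tends to [0], form a subgroup containing [S]; so
    all elements qualify, as [S] generates [G] ([generated_close]).  Closure
    under inverses matters here: [S] need not be symmetric.

    The quantifiers over [delta], [psi] and [f] are packed into one filter on
    pairs [(psi, f)], [pseudo_orbits_near].  A property holds eventually along
    it when some [delta] makes it true for all admissible pairs, so choosing a
    common [delta] for several requirements is filter intersection, persistent
    shadowing says that pairs are eventually shadowed, and restriction to [H]
    is a map that converges from the filter of [G] to the filter of [H]
    ([cvg_restrict_pseudo_orbits]). *)

(** * Uniformity from finiteness and compactness *)

Lemma near_finite_set (T : Type) (I : choiceType) (D : set I) (f : I -> set T)
    (F : set_system T) : Filter F -> finite_set D ->
  (forall i, D i -> \forall x \near F, f i x) ->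
  \forall x \near F, forall i, D i -> f i x.
Proof.
move=> FF /finite_fsetP[E ->] fD.
exact: (@filter_bigI T I E f F FF).
Qed.

Section CompactMetric.
Variables (R : realType) (X : metricType R).
Hypothesis cX : compact [set: X].
Local Open Scope ring_scope.

(** Near each point the distance to [x0] is bounded by every large [M], and
    compactness makes the bound uniform. *)
Lemma compact_mdist_bounded (x0 : X) :
  exists M, forall x, mdist x0 x <= M.
Proof.
have : \forall M \near +oo, [set: X] `<=` (fun x => mdist x0 x <= M).
  apply: (iffLR (compact_near_coveringP _) cX) => x _.
  exists (ball x 1, [set M | mdist x0 x + 1 < M]) => /=.
    split; first exact: nbhsx_ballx.
    by apply: nbhs_pinfty_gt; rewrite num_real.
  move=> [y M]/= [+ lM]; rewrite ballEmdist/= => xy.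
  apply: le_trans (ltW lM); apply: le_trans (metric_triangle _ x _) _.
  by rewrite lerD2l ltW.
by case=> M [_ HM]; exists (M + 1) => x; apply: HM => //; rewrite ltrDl.
Qed.

(** Heine-Cantor: around each [x], continuity at [x] gives one [d] whose half
    works for all points of the ball of radius [d / 2], and compactness selects
    a common one. *)
Lemma compact_unif_continuous (f : X -> X) : continuous f ->
  forall e, 0 < e ->
  exists2 d : R, 0 < d & forall x y, mdist x y < d -> mdist (f x) (f y) < e.
Proof.
move=> cf e e0.
have H : \forall d \near (0 : R)^'+,
    [set: X] `<=` (fun x => forall y, mdist x y < d -> mdist (f x) (f y) < e).
  apply: (iffLR (compact_near_coveringP _) cX) => x _.
  have e20 : 0 < e / 2 by rewrite divr_gt0.
  have [d /= d0 xd] := iffLR (nbhs_ballP _ _)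
    (metricType_numDomainType.cvgr_dist_lt (cf x) e20).
  exists (ball x (d / 2), [set r | r < d / 2]) => /=.
    by split; [apply: nbhsx_ballx|apply: nbhs_right_lt]; rewrite divr_gt0.
  move=> [y r]/= [+ rd] z yz; rewrite ballEmdist/= => xy.
  have fy : mdist (f x) (f y) < e / 2.
    by apply: xd; rewrite ballEmdist/=; lra.
  have fz : mdist (f x) (f z) < e / 2.
    apply: xd; rewrite ballEmdist/=.
    by have := metric_triangle x y z; lra.
  have := metric_triangle (f y) (f x) (f z).
  by rewrite (metric_sym (f y) (f x)); lra.
near (0 : R)^'+ => d; exists d; first by [].
by move=> x y; apply: (near H d).
Unshelve. all: by end_near.
Qed.
End CompactMetric.

(** * Continuity of the maps of an action and of its restriction *)

Section PseudoOrbitFilter.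
Variables (R : realType) (X : metricType R).
Local Open Scope ring_scope.

Lemma continuous_action_at (G : groupType) (phi : G -> X -> X) (g : G) :
  continuous_action phi -> continuous (phi g).
Proof.
move=> aphi x.
apply: (@cvg_comp _ _ _ (fun y => (g : discrete_topology G, y))
  (fun gx => phi gx.1 gx.2) _ (nbhs (g : discrete_topology G, x))).
  apply: (@cvg_pair _ _ _ _ (nbhs (g : discrete_topology G)) (nbhs x)).
    exact: cvg_cst.
  exact: cvg_id.
exact: (@action_continuous _ _ _ _ aphi (g, x)).
Qed.

Lemma continuous_action_restrict (G : groupType) (P : {pred G})
    (H : subGroupType P) (phi : G -> X -> X) :
  continuous_action phi -> continuous_action (restrict_action H phi).
Proof.
move=> aphi; split=> [x|g h x|[h x]].
- by rewrite /restrict_action val1 (action1 aphi).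
- by rewrite /restrict_action valM (actionM aphi).
- apply: (@cvg_comp _ _ _
    (fun hx : discrete_topology H * X =>
       (\val (hx.1 : H) : discrete_topology G, hx.2))
    (fun gx => phi gx.1 gx.2) _ (nbhs (\val h : discrete_topology G, x))).
    apply: (@cvg_pair _ _ _ _ (nbhs (\val h : discrete_topology G)) (nbhs x));
      last exact: cvg_snd.
    apply: (@cvg_comp _ _ _ fst
      (fun h : discrete_topology H => \val (h : H) : discrete_topology G)).
      exact: cvg_fst.
    by move=> B /principal_filterP Bh; apply/principal_filterP.
  exact: (@action_continuous _ _ _ _ aphi (\val h, x)).
Qed.

(** * The filter of pseudo orbits of perturbed actions *)

Section Filter.
Variables (G : groupType) (S : set G) (phi : G -> X -> X).

(** An element [u] stands for an action [u.1] and a map [u.2] from [G] to [X];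
    the basic sets are the pairs to which persistent shadowing with parameter
    [d] applies. *)
Definition pseudo_orbits_near : set_system ((G -> X -> X) * (G -> X)) :=
  filter_from [set d : R | 0 < d]
    (fun d => [set u | [/\ continuous_action u.1,
       action_dist S phi u.1 < d & pseudo_orbit S u.1 d u.2]]).

#[global] Instance pseudo_orbits_near_filter : Filter pseudo_orbits_near.
Proof.
apply: filter_from_filter; first by exists 1; rewrite /= ltr01.
move=> i j i0 j0; exists (Num.min i j); first by rewrite /= lt_min i0.
move=> u [cu]; rewrite lt_min => /andP[di dj] pu.
by split; split=> // s g /(pu s g); rewrite lt_min => /andP[].
Qed.

Lemma persistent_shadowingE : persistent_shadowing S phi <->
  forall eps, 0 < eps ->
    \forall u \near pseudo_orbits_near, exists p, shadowed u.1 eps u.2 p.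
Proof.
split=> sh eps eps0; have [d d0 dP] := sh _ eps0; exists d => //.
  by move=> [psi f] [apsi dpsi pf]; exact: dP.
by move=> psi apsi dpsi f pf; apply: (dP (psi, f)).
Qed.

Lemma near_continuous_action :
  \forall u \near pseudo_orbits_near, continuous_action u.1.
Proof. by exists 1; [rewrite /= ltr01|move=> u []]. Qed.

Definition uniformly_close (g : G) : Prop :=
  forall eps, 0 < eps -> \forall u \near pseudo_orbits_near,
    forall x, mdist (phi g x) (u.1 g x) < eps.

Definition orbit_close (g : G) : Prop :=
  forall eps, 0 < eps -> \forall u \near pseudo_orbits_near,
    forall k, mdist (u.2 (g * k)%g) (u.1 g (u.2 k)) < eps.

Hypotheses (cX : compact [set: X]) (aphi : continuous_action phi).

(** Compactness is what makes this true: the supremum of an unbounded set would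
    be the default value [0]. *)
Lemma le_action_dist (psi : G -> X -> X) s x :
  S s -> mdist (phi s x) (psi s x) <= action_dist S phi psi.
Proof.
move=> Ss; apply: ub_le_sup; last by exists s => //; exists x.
have [M xM] := compact_mdist_bounded cX x.
exists (M + M) => _ [t _ [y _ <-]].
apply: le_trans (metric_triangle _ x _) _.
by rewrite (metric_sym _ x) lerD.
Qed.

Lemma close_generator s : S s -> uniformly_close s /\ orbit_close s.
Proof.
move=> Ss; split=> eps eps0; exists eps => // u [_ du pu].
  by move=> x; apply: le_lt_trans du; exact: le_action_dist.
by move=> k; exact: pu.
Qed.

(** The modulus of continuity of the single map [phi g] passes to all maps
    [psi g] close to it. *)
Lemma uniformly_close_equicontinuous g : uniformly_close g ->
  forall eps, 0 < eps -> exists2 d, 0 < d &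
    \forall u \near pseudo_orbits_near,
      forall x y, mdist x y < d -> mdist (u.1 g x) (u.1 g y) < eps.
Proof.
move=> cg eps eps0; have eps30 : 0 < eps / 3 by rewrite divr_gt0.
have [d d0 dP] :=
  compact_unif_continuous cX (continuous_action_at (g := g) aphi) eps30.
exists d => //; near=> u => x y /dP phixy.
have ux : mdist (phi g x) (u.1 g x) < eps / 3.
  by move: x {phixy}; near: u; exact: cg.
have uy : mdist (phi g y) (u.1 g y) < eps / 3.
  by move: y {phixy}; near: u; exact: cg.
have := metric_triangle (u.1 g x) (phi g x) (u.1 g y).
have := metric_triangle (phi g x) (phi g y) (u.1 g y).
by rewrite (metric_sym (u.1 g x) (phi g x)); lra.
Unshelve. all: by end_near. Qed.

Lemma finite_equicontinuous (C : set G) : finite_set C ->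
  (forall c, C c -> uniformly_close c) ->
  forall eps, 0 < eps -> exists2 d, 0 < d &
    \forall u \near pseudo_orbits_near, forall c, C c ->
      forall x y, mdist x y < d -> mdist (u.1 c x) (u.1 c y) < eps.
Proof.
move=> finC closeC eps eps0.
have dC : \forall d \near 0^'+, forall c, C c ->
    \forall u \near pseudo_orbits_near,
      forall x y, mdist x y < d -> mdist (u.1 c x) (u.1 c y) < eps.
  apply: near_finite_set => // c /closeC cc.
  have [d d0 dP] := uniformly_close_equicontinuous cc eps0.
  near=> r; apply: filterS dP => u uP x y xyr; apply: uP.
  by apply: lt_trans xyr _; near: r; exact: nbhs_right_lt.
near (0 : R)^'+ => d; exists d; first by [].
by apply: near_finite_set => //; exact: (near dC d).
Unshelve. all: by end_near. Qed.

Lemma uniformly_closeM g h :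
  uniformly_close g -> uniformly_close h -> uniformly_close (g * h)%g.
Proof.
move=> cg ch eps eps0; have eps20 : 0 < eps / 2 by rewrite divr_gt0.
have [d d0 dP] :=
  compact_unif_continuous cX (continuous_action_at (g := g) aphi) eps20.
near=> u => x.
have au : continuous_action u.1 by near: u; exact: near_continuous_action.
rewrite (actionM aphi) (actionM au).
have : mdist (phi g (phi h x)) (phi g (u.1 h x)) < eps / 2.
  by apply: dP; move: x; near: u; exact: ch.
have : mdist (phi g (u.1 h x)) (u.1 g (u.1 h x)) < eps / 2.
  by move: (u.1 h x); near: u; exact: cg.
have := metric_triangle (phi g (phi h x)) (phi g (u.1 h x)) (u.1 g (u.1 h x)).
by lra.
Unshelve. all: by end_near. Qed.

(** With [y = psi g^-1 x] one has [x = psi g y], which is close to [phi g y];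
    the uniformly continuous map [phi g^-1] brings these two points to
    [phi g^-1 x] and [y]. *)
Lemma uniformly_closeV g : uniformly_close g -> uniformly_close g^-1%g.
Proof.
move=> cg eps eps0.
have [d d0 dP] :=
  compact_unif_continuous cX (continuous_action_at (g := g^-1%g) aphi) eps0.
near=> u => x.
have au : continuous_action u.1 by near: u; exact: near_continuous_action.
set y := u.1 g^-1%g x.
have -> : x = u.1 g y by rewrite -(actionM au) mulgV (action1 au).
have {2}-> : y = phi g^-1%g (phi g y).
  by rewrite -(actionM aphi) mulVg (action1 aphi).
by rewrite metric_sym; apply: dP; move: y; near: u; exact: cg.
Unshelve. all: by end_near. Qed.

(** The error made at [h] is carried by [psi g], so that it stays controlled
    only thanks to the equicontinuity of these maps. *)
Lemma orbit_closeM g h : uniformly_close g ->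
  orbit_close g -> orbit_close h -> orbit_close (g * h)%g.
Proof.
move=> cg og oh eps eps0; have eps20 : 0 < eps / 2 by rewrite divr_gt0.
have [d d0 dP] := uniformly_close_equicontinuous cg eps20.
near=> u => k.
have au : continuous_action u.1 by near: u; exact: near_continuous_action.
rewrite -mulgA (actionM au).
have : mdist (u.1 g (u.2 (h * k)%g)) (u.1 g (u.1 h (u.2 k))) < eps / 2.
  have kd : mdist (u.2 (h * k)%g) (u.1 h (u.2 k)) < d.
    by move: k; near: u; exact: oh.
  by move: kd; move: (u.2 _) (u.1 h _); near: u.
have : mdist (u.2 (g * (h * k))%g) (u.1 g (u.2 (h * k)%g)) < eps / 2.
  by move: (h * k)%g; near: u; exact: og.
have := metric_triangle (u.2 (g * (h * k))%g) (u.1 g (u.2 (h * k)%g))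
  (u.1 g (u.1 h (u.2 k))).
by lra.
Unshelve. all: by end_near. Qed.

(** Following the pseudo orbit from [g^-1 k] by [g] gives that [f k] is close to
    [psi g (f (g^-1 k))]; apply the equicontinuous maps [psi g^-1]. *)
Lemma orbit_closeV g :
  uniformly_close g -> orbit_close g -> orbit_close g^-1%g.
Proof.
move=> cg og eps eps0.
have [d d0 dP] := uniformly_close_equicontinuous (uniformly_closeV cg) eps0.
near=> u => k.
have au : continuous_action u.1 by near: u; exact: near_continuous_action.
have kd : mdist (u.2 k) (u.1 g (u.2 (g^-1 * k)%g)) < d.
  by rewrite -{1}(mulVKg g k); move: (g^-1 * k)%g; near: u; exact: og.
have -> : u.2 (g^-1 * k)%g = u.1 g^-1%g (u.1 g (u.2 (g^-1 * k)%g)).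
  by rewrite -(actionM au) mulVg (action1 au).
rewrite metric_sym.
by move: kd; move: (u.2 k) (u.1 g _); near: u.
Unshelve. all: by end_near. Qed.

Lemma generated_close : generating S ->
  forall g, uniformly_close g /\ orbit_close g.
Proof.
move=> genS g.
suff sub : smallest (@is_subgroup G) S `<=`
    [set g | uniformly_close g /\ orbit_close g].
  by apply: sub; rewrite genS.
apply: smallest_sub; last by move=> s /close_generator.
split=> [|g1 h /[!inE]/= -[cg og] [ch oh]].
  rewrite inE; split=> eps eps0; near=> u.
    have au : continuous_action u.1 by near: u; exact: near_continuous_action.
    by move=> x; rewrite (action1 aphi) (action1 au) mdistxx.
  have au : continuous_action u.1 by near: u; exact: near_continuous_action.
  by move=> k; rewrite mul1g (action1 au) mdistxx.
split; first exact/uniformly_closeM/uniformly_closeV.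
by apply: orbit_closeM => //; exact: orbit_closeV.
Unshelve. all: by end_near. Qed.

End Filter.

(** * Restriction to a subgroup and coset representatives *)

(** Generators of [H] lie outside [S] in general, so an admissible pair for [S]
    need not restrict to one for [A] with the same [delta]; closeness at the
    finitely many elements of [A] gives a smaller [delta] for which it does. *)
Lemma cvg_restrict_pseudo_orbits (G : groupType) (P : {pred G})
    (H : subGroupType P) (phi : G -> X -> X) (S : set G) (A : set H) :
  finite_set A ->
  (forall a, A a -> uniformly_close S phi (\val a) /\
                    orbit_close S phi (\val a)) ->
  (fun u : (G -> X -> X) * (G -> X) =>
     (restrict_action H u.1, fun h : H => u.2 (\val h)))
      @ pseudo_orbits_near S phi --> pseudo_orbits_near A (restrict_action H phi).
Proof.
move=> finA closeA B [d /= d0 dB].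
have d20 : 0 < d / 2 by rewrite divr_gt0.
suff : \forall u \near pseudo_orbits_near S phi,
  B (restrict_action H u.1, fun h : H => u.2 (\val h)) by [].
near=> u; apply: dB; split=> /=.
- have au : continuous_action u.1 by near: u; exact: near_continuous_action.
  exact: continuous_action_restrict au.
- apply: (@le_lt_trans _ _ (d / 2)); last by lra.
  have uA : forall a, A a -> forall x,
      mdist (phi (\val a) x) (u.1 (\val a) x) < d / 2.
    near: u; apply: near_finite_set => // a /closeA[ca _]; exact: ca.
  (* The strict bound [d] is reached from [d / 2], as a supremum of numbers
     below [d] could be [d] itself. *)
  rewrite /action_dist; set D := (X in sup X).
  have [->|/set0P D0] := eqVneq D set0; first by rewrite sup0 ltW.
  by apply: ge_sup => // _ [a Aa [x _ <-]]; exact/ltW/uA.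
- have uA : forall a, A a -> forall k,
      mdist (u.2 (\val a * k)%g) (u.1 (\val a) (u.2 k)) < d.
    near: u; apply: near_finite_set => // a /closeA[_ oa]; exact: oa.
  by move=> a h Aa; rewrite /= valM; exact: uA.
Unshelve. all: by end_near. Qed.

End PseudoOrbitFilter.

(** A representative chosen as a function of the coset takes only finitely many
    values. *)
Lemma finite_index_representatives (G : groupType) (P : {pred G})
    (H : subGroupType P) : finite_index P ->
  exists2 C : set G, finite_set C &
    forall g, exists2 c, C c & exists h : H, g = (c * \val h)%g.
Proof.
move=> finP.
pose rep B := xget 1%g [set c : G | left_coset P c = B].
exists (rep @` range (left_coset P)); first exact: finite_image.
move=> g; exists (rep (left_coset P g)); first by exists (left_coset P g).
have repE : left_coset P (rep (left_coset P g)) = left_coset P g.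
  exact: (xgetPex 1%g
    (ex_intro [set c | left_coset P c = left_coset P g] g erefl)).
have : left_coset P (rep (left_coset P g)) g.
  rewrite repE; exists 1%g; last by rewrite mulg1.
  by rewrite /= -(val1 H); exact: valP.
by move=> [h Ph gE]; exists (Sub h Ph); rewrite SubK gE.
Qed.

Theorem proposition2p4 (R : realType) (X : metricType R) (G : groupType)
    (P : {pred G}) (H : subGroupType P) (phi : G -> X -> X)
    (S : set G) (A : set H) :
  compact [set: X] ->
  continuous_action phi ->
  finite_index P ->
  finite_set S -> generating S ->
  finite_set A -> generating A ->
  persistent_shadowing A (restrict_action H phi) ->
  persistent_shadowing S phi.
Proof.
move=> cX aphi finP _ genS finA _ /persistent_shadowingE shH.
have closeG := generated_close cX aphi genS.
apply/persistent_shadowingE => eps eps0.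
have [C finC CH] := finite_index_representatives H finP.
have eps20 : (0 < eps / 2)%R by rewrite divr_gt0.
have [d d0 dC] := finite_equicontinuous cX aphi finC
  (fun c _ => proj1 (closeG c)) eps20.
have shadowH :=
  cvg_restrict_pseudo_orbits finA (fun a _ => closeG (\val a)) (shH _ d0).
near=> u.
have au : continuous_action u.1 by near: u; exact: near_continuous_action.
have [p up] : exists p,
    shadowed (restrict_action H u.1) d (fun h : H => u.2 (\val h)) p.
  by near: u.
exists p => g; have [c Cc [h ->]] := CH g.
rewrite (actionM au).
have : (mdist (u.2 (c * \val h)%g) (u.1 c (u.2 (\val h))) < eps / 2)%R.
  move: {h}(\val h); move: c Cc; near: u; apply: near_finite_set => // c _.
  by case: (closeG c) => _; exact.
have : (mdist (u.1 c (u.2 (\val h))) (u.1 c (u.1 (\val h) p)) < eps / 2)%R.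
  have := up h; rewrite /restrict_action/=.
  by move: (u.2 _) (u.1 (\val h) p); move: c Cc; near: u.
have := metric_triangle (u.2 (c * \val h)%g) (u.1 c (u.2 (\val h)))
  (u.1 c (u.1 (\val h) p)).
by lra.
Unshelve. all: by end_near. Qed.
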